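(* Let $\epsilon,\mu>0$ be constants, let $\mathbf{w}\in\mathbb{R}^3\setminus\{0\}$, $\mathbf{a}_{\mathbf{w}}\in\mathbb{C}^3$, and $\alpha_{\mathbf{w}}=(\alpha_{1,\mathbf{w}},\alpha_{2,\mathbf{w}},\alpha_{3,\mathbf{w}})^T=V_{\mathbf{w}}^\dagger\mathbf{a}_{\mathbf{w}}$, so that $F_{0,\mathbf{w}}(\mathbf{x}):=\mathbf{a}_{\mathbf{w}}e^{i\mathbf{x}\cdot\mathbf{w}}=\sum_{1\le d\le 3}\alpha_{d,\mathbf{w}}\mathbf{v}_{d,\mathbf{w}}e^{i\mathbf{x}\cdot\mathbf{w}}$. Let $$F_{\alpha_{\mathbf{w}},\mathbf{w}}(\mathbf{x},t)=\sum_{1\le d\le3}e^{\frac{-it\mu_{d,\mathbf{w}}}{\sqrt{\mu\epsilon}}}\,\alpha_{d,\mathbf{w}}\mathbf{v}_{d,\mathbf{w}}e^{i\mathbf{x}\cdot\mathbf{w}},$$ $$E_{\alpha_{\mathbf{w}},\mathbf{w}}=\frac12\left(F_{\alpha_{\mathbf{w}},\mathbf{w}}+\overline{F_{\alpha_{\mathbf{w}},\mathbf{w}}}\right),\qquad H_{\alpha_{\mathbf{w}},\mathbf{w}}=\frac i2\left(\overline{F_{\alpha_{\mathbf{w}},\mathbf{w}}}-F_{\alpha_{\mathbf{w}},\mathbf{w}}\right).$$ Then $E_{\alpha_{\mathbf{w}},\mathbf{w}}$ is orthogonal to $H_{\alpha_{\mathbf{w}},\mathbf{w}}$ (at all $\mathbf{x}$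 and all $t$) if they are initially orthogonal to each other (at $t=0$, for all $\mathbf{x}$), and this is equivalent to the condition $$\alpha_{1,\mathbf{w}}^2+2\alpha_{2,\mathbf{w}}\alpha_{3,\mathbf{w}}=0.$$ In particular, if $E_{\alpha_{\mathbf{w}},\mathbf{w}}$ and $H_{\alpha_{\mathbf{w}},\mathbf{w}}$ are transverse, i.e. perpendicular to the wave propagation direction $\mathbf{w}$, then they are perpendicular to each other if and only if $\alpha_{2,\mathbf{w}}\alpha_{3,\mathbf{w}}=0$.
   Context: For $\mathbf{w}=(w_1,w_2,w_3)^T\in\mathbb{R}^3\setminus\{0\}$ put $s_{\mathbf{w}}=w_1+w_2+w_3$, $\mathbf{r}_{\mathbf{w}}=(w_2-w_3,w_3-w_1,w_1-w_2)^T$, $\nu_{\mathbf{w}}=\sqrt2\,|\mathbf{r}_{\mathbf{w}}|/|\mathbf{w}|$, and $\mu_{1,\mathbf{w}}=0$, $\mu_{2,\mathbf{w}}=-|\mathbf{w}|$, $\mu_{3,\mathbf{w}}=|\mathbf{w}|$ (not to be confused with the constant $\mu$). Put $\mathbf{v}_{1,\mathbf{w}}=\mathbf{w}/|\mathbf{w}|$. If $\mathbf{r}_{\mathbf{w}}\neq0$, put for $d=2,3$ $$\mathbf{v}_{d,\mathbf{w}}=\frac{1}{\nu_{\mathbf{w}}}\left(\frac{s_{\mathbf{w}}}{|\mathbf{w}|^2}\mathbf{w}-(1,1,1)^T-i\frac{\mu_{d,\mathbf{w}}}{|\mathbf{w}|^2}\mathbf{r}_{\mathbf{w}}\right).$$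 If $\mathbf{r}_{\mathbf{w}}=0$, i.e. $w_1=w_2=w_3=\omega$, let $v_2=\frac{1}{\sqrt3}\left(\frac{1+i\sqrt3}{2},\frac{1-i\sqrt3}{2},-1\right)^T$ and put $\mathbf{v}_{2,\mathbf{w}}=v_2$ if $\omega\ge0$, $\mathbf{v}_{2,\mathbf{w}}=\overline{v_2}$ if $\omega<0$, and $\mathbf{v}_{3,\mathbf{w}}=\overline{\mathbf{v}_{2,\mathbf{w}}}$. $V_{\mathbf{w}}$ is the matrix with columns $\mathbf{v}_{1,\mathbf{w}},\mathbf{v}_{2,\mathbf{w}},\mathbf{v}_{3,\mathbf{w}}$ and $V_{\mathbf{w}}^\dagger$ its conjugate transpose. The vectors $E_{\alpha_{\mathbf{w}},\mathbf{w}},H_{\alpha_{\mathbf{w}},\mathbf{w}}$ are $\mathbb{R}^3$-valued (real and imaginary parts of $F_{\alpha_{\mathbf{w}},\mathbf{w}}$), and orthogonality is with respect to the Euclidean dot product on $\mathbb{R}^3$. *)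

(* Defs.v *)
From mathcomp Require Import all_boot all_order all_algebra.
From mathcomp Require Import complex.
From mathcomp Require Import reals topology normedtype sequences exp trigo.

Set Implicit Arguments.
Unset Strict Implicit.
Unset Printing Implicit Defensive.

Import Order.TTheory GRing.Theory Num.Theory.

Local Open Scope ring_scope.
Local Open Scope complex_scope.
Local Open Scope sesquilinear_scope.

(* Coordinates 1, 2, 3 are the indices 0, 1, 2 of 'I_3. *)

Definition vec3 (T : nmodType) (a b c : T) : 'cV[T]_3 :=
  \col_(i < 3) [:: a; b; c]`_i.

Section Waves.
Variable R : realType.
Implicit Types (w x : 'cV[R]_3) (a alpha : 'cV[R[i]]_3) (d : 'I_3) (t eps mu : R).

Definition cvec w : 'cV[R[i]]_3 := map_mx (real_complex R) w.

Definition dotp (u v : 'cV[R]_3) : R := \sum_(i < 3) u i 0 * v i 0.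

(* The library norm `|w| on matrices is the sup norm, hence this one. *)
Definition enorm w : R := Num.sqrt (dotp w w).

Definition cexp (z : R[i]) : R[i] :=
  (expR (complex.Re z))%:C * (cos (complex.Im z) +i* sin (complex.Im z)).

Definition sw w : R := w 0 0 + w 1 0 + w 2 0.

Definition rw w : 'cV[R]_3 :=
  vec3 (w 1 0 - w 2 0) (w 2 0 - w 0 0) (w 0 0 - w 1 0).

Definition nuw w : R := Num.sqrt 2 * enorm (rw w) / enorm w.

Definition muw w d : R := [:: 0; - enorm w; enorm w]`_d.

Definition vdeg : 'cV[R[i]]_3 :=
  (Num.sqrt 3)^-1%:C *:
    vec3 ((1 + 'i * (Num.sqrt 3)%:C) / 2) ((1 - 'i * (Num.sqrt 3)%:C) / 2) (-1).

(* When rw w = 0, the sign of the common value of the coordinates is read off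
   the first one. *)
Definition v2deg w : 'cV[R[i]]_3 :=
  if 0 <= w 0 0 then vdeg else map_mx Num.conj vdeg.

Definition vw w d : 'cV[R[i]]_3 :=
  if d == 0 then (enorm w)^-1%:C *: cvec w
  else if rw w != 0 then
    (nuw w)^-1%:C *:
      ((sw w / enorm w ^+ 2)%:C *: cvec w - const_mx 1
       - ('i * (muw w d / enorm w ^+ 2)%:C) *: cvec (rw w))
  else if d == 1 then v2deg w
  else map_mx Num.conj (v2deg w).

Definition Vw w : 'M[R[i]]_3 := \matrix_(i, d) vw w d i 0.

Definition planewave w x : R[i] := cexp ('i * (dotp x w)%:C).

Definition Fw eps mu w alpha x t : 'cV[R[i]]_3 :=
  \sum_(d < 3)
    (cexp (- 'i * (t * muw w d / Num.sqrt (mu * eps))%:C)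
     * alpha d 0 * planewave w x) *: vw w d.

Definition Ecw eps mu w alpha x t : 'cV[R[i]]_3 :=
  let F := Fw eps mu w alpha x t in 2^-1 *: (F + map_mx Num.conj F).

Definition Hcw eps mu w alpha x t : 'cV[R[i]]_3 :=
  let F := Fw eps mu w alpha x t in ('i / 2) *: (map_mx Num.conj F - F).

(* [Ecw] and [Hcw] have real entries (lemmas [cvec_Ew] and [cvec_Hw] below);
   these are the same fields as vectors of R^3. *)
Definition Ew eps mu w alpha x t : 'cV[R]_3 :=
  map_mx (@complex.Re R) (Ecw eps mu w alpha x t).

Definition Hw eps mu w alpha x t : 'cV[R]_3 :=
  map_mx (@complex.Re R) (Hcw eps mu w alpha x t).

Lemma half_complexE : (2^-1 : R[i]) = (2^-1)%:C.
Proof. by rewrite fmorphV rmorph_nat. Qed.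

Lemma cvec_Ew eps mu w alpha x t :
  cvec (Ew eps mu w alpha x t) = Ecw eps mu w alpha x t.
Proof.
apply/matrixP => i j; rewrite /Ew /Ecw !mxE half_complexE.
case: (Fw _ _ _ _ _ _ i j) => p q.
by apply/eqP; rewrite eq_complex /= subrr !mulr0 mul0r addr0 !eqxx.
Qed.

Lemma cvec_Hw eps mu w alpha x t :
  cvec (Hw eps mu w alpha x t) = Hcw eps mu w alpha x t.
Proof.
apply/matrixP => i j; rewrite /Hw /Hcw !mxE half_complexE.
case: (Fw _ _ _ _ _ _ i j) => p q.
by apply/eqP; rewrite eq_complex /= subrr !(mulr0, mul0r, addr0, subr0) !eqxx.
Qed.

End Waves.

(* Main.v *)
(* For F = E + iH the bilinear (not Hermitian) square is
   F.F = |E|^2 - |H|^2 + 2i E.H.  In the bilinear product, v_1.v_1 = v_2.v_3 = 1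
   and all other products of the v_d vanish, since v_1 is real and
   v_3 = conj v_2 in a Hermitian-orthonormal frame.  The phases of the modes 2
   and 3 are inverse to each other, so
   F.F = e^{2i x.w} (alpha_1^2 + 2 alpha_2 alpha_3) at every time, and as x varies
   e^{2i x.w} covers the unit circle.  Transversality forces alpha_1 = 0 because
   F.w is alpha_1 |w| times a unit. *)

Require Import Defs.
From mathcomp Require Import all_boot all_order all_algebra.
From mathcomp Require Import complex reals exp trigo.
From mathcomp Require Import ring lra.

Set Implicit Arguments.
Unset Strict Implicit.
Unset Printing Implicit Defensive.

Import Order.TTheory GRing.Theory Num.Theory.

Local Open Scope ring_scope.
Local Open Scope complex_scope.
Local Open Scope sesquilinear_scope.

Lemma sum_ord3 (T : nmodType) (f : 'I_3 -> T) :
  \sum_(i < 3) f i = f 0 + f 1 + f 2.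
Proof.
by rewrite !big_ord_recl big_ord0 addr0 addrA; congr (_ + f _ + f _); apply: val_inj.
Qed.

Lemma ord3P (P : 'I_3 -> Prop) : P 0 -> P 1 -> P 2 -> forall i, P i.
Proof.
move=> P0 P1 P2 [[|[|[|//]]] lt_i].
- by rewrite (_ : Ordinal _ = 0) //; apply: val_inj.
- by rewrite (_ : Ordinal _ = 1) //; apply: val_inj.
- by rewrite (_ : Ordinal _ = 2) //; apply: val_inj.
Qed.

(** * Geometry of the eigenvector frame over the reals *)

Section Frame.
Variable R : realType.
Implicit Types (w p q x : 'cV[R]_3) (u v : 'cV[R[i]]_3) (d : 'I_3).

Lemma dotp3 p q : dotp p q = p 0 0 * q 0 0 + p 1 0 * q 1 0 + p 2 0 * q 2 0.
Proof. exact: sum_ord3. Qed.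

Lemma dotpp_ge0 w : 0 <= dotp w w.
Proof. by apply: sumr_ge0 => i _; rewrite -expr2 sqr_ge0. Qed.

Lemma enorm_sqr w : enorm w ^+ 2 = dotp w w.
Proof. exact/sqr_sqrtr/dotpp_ge0. Qed.

Lemma enorm_eq0 w : (enorm w == 0) = (w == 0).
Proof.
rewrite -sqrf_eq0 enorm_sqr psumr_eq0; last by move=> i _; rewrite -expr2 sqr_ge0.
apply/allP/eqP => [w0|-> i _]; last by rewrite mxE mulr0 eqxx.
apply/colP => i; rewrite mxE; apply/eqP.
by rewrite -sqrf_eq0 expr2 (implyP (w0 i (mem_index_enum i))).
Qed.

(** Lagrange's identity: [rw w] is the cross product of [w] with (1,1,1), and [sw w] is their dot
    product. *)
Lemma rw_sqr w : dotp (rw w) (rw w) = 3 * dotp w w - sw w ^+ 2.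
Proof. by rewrite !dotp3 /sw !mxE /=; ring. Qed.

(** Gives the generic and the degenerate case a common real form, so that later arguments need no
    case split on [rw w]. The value 1/2 makes p + iq isotropic and its product with p - iq equal to
    1. *)
Lemma vw_frame w : w != 0 -> exists p q,
  [/\ vw w 1 = \col_i (p i 0 +i* q i 0), vw w 2 = \col_i (p i 0 -i* q i 0)
    & [/\ dotp p w = 0, dotp q w = 0, dotp p q = 0,
        dotp p p = 2^-1 & dotp q q = 2^-1]].
Proof.
move=> w_neq0; have n_neq0 : enorm w != 0 by rewrite enorm_eq0.
have [r_neq0|/negPn/eqP r_eq0] := boolP (rw w != 0).
  have nr_neq0 : enorm (rw w) != 0 by rewrite enorm_eq0.
  have nu_neq0 : nuw w != 0.
    by rewrite !mulf_neq0 ?invr_neq0 // sqrtr_eq0 -ltNge ltr0n.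
  have nu2 : nuw w ^+ 2 = 2 * (3 - sw w ^+ 2 / enorm w ^+ 2).
    by rewrite !exprMn exprVn sqr_sqrtr // [enorm (rw w) ^+ 2]enorm_sqr
      rw_sqr -enorm_sqr; field.
  have n2 := enorm_sqr w; rewrite dotp3 in n2.
  (* Up to the factor 1/nu, p is minus the component of (1,1,1) orthogonal to [w]. The vector q is a
     multiple of the cross product [rw w], hence orthogonal to both [w] and p. *)
  exists ((nuw w)^-1 *: ((sw w / enorm w ^+ 2) *: w - const_mx 1)).
  exists ((nuw w * enorm w)^-1 *: rw w).
  have vwE d : d != 0 -> vw w d = \col_i
      ((nuw w)^-1 * (sw w / enorm w ^+ 2 * w i 0 - 1)
       +i* (- ((nuw w)^-1 * (muw w d / enorm w ^+ 2) * rw w i 0))).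
    rewrite /vw r_neq0 => /negPf ->; apply/colP => i; rewrite !mxE.
    apply/eqP; rewrite eq_complex /=.
    by apply/andP; split; apply/eqP; ring.
  split.
  - rewrite vwE //; apply/colP => i; rewrite !mxE /= /muw /=.
    by apply/eqP; rewrite eq_complex /= eqxx /=; apply/eqP; field; apply/andP.
  - rewrite vwE //; apply/colP => i; rewrite !mxE /= /muw /=.
    by apply/eqP; rewrite eq_complex /= eqxx /=; apply/eqP; field; apply/andP.
  (* Writing 1/2 through nu turns both norm goals into rational identities, free of the square root
     defining nu. *)
  have half : 2^-1 = (3 - sw w ^+ 2 / enorm w ^+ 2) / nuw w ^+ 2.
    rewrite -[3 - _](mulKf (_ : 2 != 0)) ?pnatr_eq0 // -nu2 mulfK //.
    by rewrite sqrf_eq0.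
  split; rewrite dotp3 !mxE /=.
  - transitivity ((nuw w)^-1 * (sw w / enorm w ^+ 2 *
      (w 0 0 * w 0 0 + w 1 0 * w 1 0 + w 2 0 * w 2 0) - sw w)).
      by rewrite /sw; ring.
    by rewrite -n2; field; rewrite ?n_neq0 ?nu_neq0.
  - by ring.
  - by ring.
  - rewrite half; transitivity ((nuw w)^-1 ^+ 2 * ((sw w / enorm w ^+ 2) ^+ 2 *
      (w 0 0 * w 0 0 + w 1 0 * w 1 0 + w 2 0 * w 2 0)
      - 2 * (sw w / enorm w ^+ 2) * sw w + 3)).
      by rewrite /sw; ring.
    by rewrite -n2; field; rewrite ?n_neq0 ?nu_neq0.
  - rewrite half; transitivity ((nuw w * enorm w)^-1 ^+ 2 * (3 *
      (w 0 0 * w 0 0 + w 1 0 * w 1 0 + w 2 0 * w 2 0) - sw w ^+ 2)).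
      by rewrite /sw; ring.
    by rewrite -n2; field; rewrite ?n_neq0 ?nu_neq0.
have w12 : w 1 0 = w 2 0.
  by move/colP/(_ 0): r_eq0; rewrite !mxE /= => /eqP; rewrite subr_eq0 => /eqP.
have w20 : w 2 0 = w 0 0.
  by move/colP/(_ 1): r_eq0; rewrite !mxE /= => /eqP; rewrite subr_eq0 => /eqP.
pose h : R := 2^-1.
(* The conjugation in [v2deg] for negative coordinates only flips the sign of q. *)
pose c : R := (-1) ^+ (w 0 0 < 0)%R.
pose r : R := Num.sqrt 3; have r2 : r ^+ 2 = 3 by rewrite sqr_sqrtr.
have r_neq0 : r != 0 by rewrite sqrtr_eq0 -ltNge ltr0n.
exists (r^-1 *: vec3 h h (-1)), (c *: vec3 h (- h) 0); split.
- rewrite /vw r_eq0 eqxx /=; apply/colP; rewrite /v2deg /c leNgt.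
  case: (w 0 0 < 0); apply: ord3P; rewrite !mxE /= ?half_complexE -?/h -?/r;
    by apply/eqP; rewrite eq_complex /=; apply/andP; split; apply/eqP; field.
- rewrite /vw r_eq0 eqxx /=; apply/colP; rewrite /v2deg /c leNgt.
  case: (w 0 0 < 0); apply: ord3P; rewrite !mxE /= ?half_complexE -?/h -?/r;
    by apply/eqP; rewrite eq_complex /=; apply/andP; split; apply/eqP; field.
rewrite !dotp3 !mxE /= w12 w20; split.
- by rewrite /h; field.
- by ring.
- by ring.
- by transitivity (3 / 2 / r ^+ 2); [rewrite /h; field | rewrite r2; field].
- by rewrite /c /h; case: (_ < _) => /=; field.
Qed.
End Frame.

(** * Bilinear products of the frame and of the fields, and phases of the plane wave *)

Section Field.
Variable R : realType.
Implicit Types (w x : 'cV[R]_3) (u v alpha : 'cV[R[i]]_3) (d e : 'I_3).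

Lemma cexpiE (r : R) : cexp ('i * r%:C) = cos r +i* sin r.
Proof. by rewrite /cexp [_ * r%:C]mulrC ReiNIm ImiRe /= oppr0 expR0 mul1r. Qed.

Lemma cexpi0 : cexp ('i * 0%:C) = 1 :> R[i].
Proof. by rewrite cexpiE cos0 sin0. Qed.

Lemma cexpiD (r s : R) :
  cexp ('i * (r + s)%:C) = cexp ('i * r%:C) * cexp ('i * s%:C).
Proof.
by rewrite !cexpiE cosD sinD; apply/eqP; rewrite eq_complex /= eqxx addrC eqxx.
Qed.

Lemma cexpi_neq0 (r : R) : cexp ('i * r%:C) != 0.
Proof.
apply/eqP => r0; have := cexpiD r (- r).
by rewrite subrr cexpi0 r0 mul0r; apply/eqP/oner_neq0.
Qed.

Definition cdot u v : R[i] := \sum_(i < 3) u i 0 * v i 0.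

Lemma cdotC u v : cdot u v = cdot v u.
Proof. by apply: eq_bigr => i _; rewrite mulrC. Qed.

Lemma cdotZl (k : R[i]) u v : cdot (k *: u) v = k * cdot u v.
Proof. by rewrite mulr_sumr; apply: eq_bigr => i _; rewrite mxE mulrA. Qed.

Lemma cdot_suml (I : finType) (f : I -> 'cV[R[i]]_3) v :
  cdot (\sum_k f k) v = \sum_k cdot (f k) v.
Proof.
rewrite /cdot exchange_big; apply: eq_bigr => i _.
by rewrite summxE mulr_suml.
Qed.

Lemma vw0E w : vw w 0 = \col_i (((enorm w)^-1 * w i 0) +i* 0).
Proof.
apply/colP => i; rewrite /vw eqxx !mxE.
by apply/eqP; rewrite eq_complex /= !mul0r mulr0 subr0 addr0 !eqxx.
Qed.

Lemma cvec_vw0 w : w != 0 -> cvec w = (enorm w)%:C *: vw w 0.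
Proof.
by move=> w_neq0; rewrite /vw eqxx scalerA -rmorphM divff ?enorm_eq0 // scale1r.
Qed.

(* The opposite in 'I_3 (integers mod 3) fixes 0 and exchanges 1 and 2, as
   conjugation does with the eigenvectors. *)
Lemma conj_vw w d : w != 0 -> map_mx Num.conj (vw w d) = vw w (- d).
Proof.
move=> /vw_frame[p [q [v1 v2 _]]]; apply/colP => i; move: d; apply: ord3P.
- by rewrite oppr0 vw0E !mxE; apply/eqP; rewrite eq_complex /= oppr0 !eqxx.
- by rewrite (_ : - 1 = 2) ?v1 ?v2 ?mxE //; apply: val_inj.
- rewrite (_ : - 2 = 1) ?v1 ?v2 ?mxE; last exact: val_inj.
  by apply/eqP; rewrite eq_complex /= opprK !eqxx.
Qed.

(** Modulo 3, the condition d + e = 0 singles out the pairs (0,0), (1,2) and (2,1). *)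
Lemma cdot_vw w d e : w != 0 -> cdot (vw w d) (vw w e) = (d + e == 0)%:R.
Proof.
move=> w_neq0; have [p [q [v1 v2 [pw qw pq pp qq]]]] := vw_frame w_neq0.
have n2 : (enorm w)^-1 ^+ 2 * dotp w w = 1.
  by rewrite -enorm_sqr -exprMn mulVf ?expr1n ?enorm_eq0.
(* Scaled like the entries of [vw w 0], these relations make every goal linear in its monomials,
   within reach of [lra]. *)
have {}pw : (enorm w)^-1 * dotp p w = 0 by rewrite pw mulr0.
have {}qw : (enorm w)^-1 * dotp q w = 0 by rewrite qw mulr0.
rewrite !dotp3 in pw qw pq pp qq n2.
move: d e; apply: ord3P; apply: ord3P; rewrite /cdot sum_ord3 ?vw0E ?v1 ?v2 !mxE;
  apply/eqP; rewrite eq_complex /=; apply/andP; split; apply/eqP.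
all: lra.
Qed.

(** The columns of [Vw w] are Hermitian-orthonormal, and a left inverse of a square matrix is also a
    right inverse. *)
Lemma vw_resolution w (a : 'cV[R[i]]_3) : w != 0 ->
  a = \sum_d ((Vw w)^t* *m a) d 0 *: vw w d.
Proof.
move=> w_neq0.
have VV : (Vw w)^t* *m Vw w = 1%:M.
  apply/matrixP => d e; rewrite !mxE.
  transitivity (cdot (vw w (- d)) (vw w e)).
    by rewrite -conj_vw //; apply: eq_bigr => i _; rewrite !mxE.
  by rewrite cdot_vw // addrC subr_eq0 eq_sym.
rewrite -{1}[a]mul1mx -(mulmx1C VV) -mulmxA; apply/colP => i.
by rewrite mxE summxE; apply: eq_bigr => d _; rewrite !mxE mulrC.
Qed.

Lemma planewave_neq0 w x : planewave w x != 0.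
Proof. exact: cexpi_neq0. Qed.

Lemma phase_muw0 w (t s : R) : cexp (- 'i * (t * muw w 0 / s)%:C) = 1.
Proof. by rewrite /muw /= mulr0 mul0r mulNr -mulrN -rmorphN oppr0 cexpi0. Qed.

Lemma cdot_Fw (eps mu : R) w alpha x t : w != 0 ->
  let F := Fw eps mu w alpha x t in
  cdot F F = planewave w x ^+ 2 * (alpha 0 0 ^+ 2 + 2 * alpha 1 0 * alpha 2 0).
Proof.
move=> w_neq0 F.
pose T := t * enorm w / Num.sqrt (mu * eps).
pose c d : R[i] := cexp (- 'i * (t * muw w d / Num.sqrt (mu * eps))%:C)
  * alpha d 0 * planewave w x.
have cE d e : cdot (c d *: vw w d) (c e *: vw w e) = c d * c e * (d + e == 0)%:R.
  by rewrite cdotZl cdotC cdotZl cdot_vw // mulrA addrC.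
(* The double sum collapses, since mode d pairs only with mode -d. *)
rewrite cdot_suml (eq_bigr (fun d => c d * c (- d))) => [|d _]; last first.
  rewrite cdotC cdot_suml (bigD1 (- d)) //= big1 => [|e].
    by rewrite cE addNr eqxx mulr1 addr0 mulrC.
  by rewrite -addr_eq0 cE => /negPf ->; rewrite mulr0.
rewrite sum_ord3 oppr0 (_ : - 1 = 2 :> 'I_3); last exact: val_inj.
rewrite (_ : - 2 = 1 :> 'I_3); last exact: val_inj.
have c0 : c 0 = alpha 0 0 * planewave w x.
  by rewrite /c phase_muw0 mul1r.
have cc : c 1 * c 2 = alpha 1 0 * alpha 2 0 * planewave w x ^+ 2.
  rewrite /c /muw /= !(mulNr, mulrN, rmorphN) opprK.
  (* Modes 1 and 2 carry the phases T and -T; their product is 1, and time disappears. *)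
  have := cexpiD T (- T); rewrite subrr cexpi0 rmorphN mulrN => TN.
  rewrite -/T -[RHS]mul1r TN; ring.
by rewrite [c 2 * _]mulrC cc c0; ring.
Qed.

(** Coordinate by coordinate this is Im (p + iq)^2 = 2pq, with p and q the entries of [Ew] and
    [Hw]. *)
Lemma dotp_Ew_Hw (eps mu : R) w alpha x t :
  let F := Fw eps mu w alpha x t in
  dotp (Ew eps mu w alpha x t) (Hw eps mu w alpha x t)
  = 2^-1 * complex.Im (cdot F F).
Proof.
move=> F; rewrite /dotp /cdot raddf_sum mulr_sumr; apply: eq_bigr => i _.
rewrite !mxE half_complexE -/F; case: (F i 0) => p q /=.
by field.
Qed.

(** Merges the two real transversality conditions into one complex equation F.w = 0. *)
Lemma cdot_Fw_cvec (eps mu : R) w alpha x t :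
  cdot (Fw eps mu w alpha x t) (cvec w) = dotp (Ew eps mu w alpha x t) w
    +i* dotp (Hw eps mu w alpha x t) w.
Proof.
rewrite [RHS]complexE /=; set F := Fw eps mu w alpha x t.
rewrite /cdot /dotp !raddf_sum /= mulr_sumr -big_split; apply: eq_bigr => i _.
rewrite !mxE half_complexE -/F; case: (F i 0) => p q /=.
by apply/eqP; rewrite eq_complex /=; apply/andP; split; apply/eqP; field.
Qed.

Lemma planewave_sqr_surj w (r : R) : w != 0 ->
  exists x, planewave w x ^+ 2 = cos r +i* sin r.
Proof.
(* The multiple of [w] with x.w = r/2; squaring doubles the phase to r. *)
move=> w_neq0; exists ((r / 2 / dotp w w) *: w).
rewrite expr2 /planewave -cexpiD -cexpiE; congr (cexp ('i * _%:C)).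
have : dotp w w != 0 by rewrite -enorm_sqr sqrf_eq0 enorm_eq0.
by rewrite !dotp3 !mxE => ww_neq0; field.
Qed.

Lemma Im_planewave_eq0 w (q : R[i]) : w != 0 ->
  (forall x, complex.Im (planewave w x ^+ 2 * q) = 0) -> q = 0.
Proof.
move=> w_neq0 Imq.
(* Phase 0 leaves q unchanged and tests its imaginary part; phase pi/2 multiplies q by i and tests
   its real part. *)
have [x0 pw0] := planewave_sqr_surj 0 w_neq0.
have [x1 pw1] := planewave_sqr_surj (pi / 2) w_neq0.
move: (Imq x0) (Imq x1); rewrite pw0 pw1 cos0 sin0 cos_pihalf sin_pihalf.
case: q {Imq} => a b /= ImE ReE.
by apply/eqP; rewrite eq_complex /=; apply/andP; split; apply/eqP; lra.
Qed.

End Field.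

Theorem corollary2p6 (R : realType) (eps mu : R) (heps : 0 < eps) (hmu : 0 < mu)
    (w : 'cV[R]_3) (hw : w != 0) (a alpha : 'cV[R[i]]_3)
    (halpha : alpha = (Vw w)^t* *m a) :
  let E := Ew eps mu w alpha in
  let H := Hw eps mu w alpha in
  [/\ forall x : 'cV[R]_3,
        planewave w x *: a
        = \sum_(d < 3) (alpha d 0 * planewave w x) *: vw w d,
      (forall x, dotp (E x 0) (H x 0) = 0) ->
        forall x t, dotp (E x t) (H x t) = 0,
      (forall x, dotp (E x 0) (H x 0) = 0)
        <-> alpha 0 0 ^+ 2 + 2 * alpha 1 0 * alpha 2 0 = 0,
      (forall x t, dotp (E x t) (H x t) = 0)
        <-> alpha 0 0 ^+ 2 + 2 * alpha 1 0 * alpha 2 0 = 0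
    & (forall x t, dotp (E x t) w = 0 /\ dotp (H x t) w = 0) ->
        ((forall x t, dotp (E x t) (H x t) = 0) <-> alpha 1 0 * alpha 2 0 = 0)].
Proof.
move=> E H.
set Q := alpha 0 0 ^+ 2 + 2 * alpha 1 0 * alpha 2 0.
have EH x t : dotp (E x t) (H x t) = 2^-1 * complex.Im (planewave w x ^+ 2 * Q).
  by rewrite dotp_Ew_Hw cdot_Fw.
have Q0_EH : Q = 0 -> forall x t, dotp (E x t) (H x t) = 0.
  by move=> Q0 x t; rewrite EH Q0 !mulr0.
have EH_Q0 : (forall x, dotp (E x 0) (H x 0) = 0) -> Q = 0.
  move=> EH0; apply: (Im_planewave_eq0 hw) => x; have := EH0 x.
  by rewrite EH => /eqP; rewrite mulf_eq0 invr_eq0 pnatr_eq0 => /eqP.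
have EHP : (forall x t, dotp (E x t) (H x t) = 0) <-> Q = 0.
  by split=> [EH0|//]; apply: EH_Q0.
split=> //.
- move=> x; rewrite {1}(vw_resolution a hw) -halpha scaler_sumr.
  by apply: eq_bigr => d _; rewrite scalerA mulrC.
- by move=> /EH_Q0/Q0_EH.
- by split=> [/EH_Q0|/Q0_EH].
move=> /(_ 0 0)[Ew0 Hw0]; rewrite EHP /Q.
have alpha0 : alpha 0 0 = 0.
  have : cdot (Fw eps mu w alpha 0 0) (cvec w) = 0.
    by rewrite cdot_Fw_cvec -/E -/H Ew0 Hw0.
  (* As [w] is a multiple of [vw w 0], only mode 0 of F survives; its coefficient vanishes because
     [enorm w] and the plane wave do not. *)
  rewrite cvec_vw0 // cdotC cdotZl cdotC cdot_suml.
  rewrite (bigD1 0) //= big1 => [|d d_neq0].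
    rewrite cdotZl cdot_vw // !addr0 mulr1.
    rewrite phase_muw0 mul1r => /eqP.
    rewrite mulf_eq0 (fmorph_eq0 (real_complex R)) enorm_eq0 (negPf hw).
    by rewrite mulf_eq0 (negPf (planewave_neq0 w 0)) orbF => /eqP.
  by rewrite cdotZl cdot_vw // addr0 (negPf d_neq0) mulr0.
rewrite alpha0 expr0n add0r -mulrA; split=> [/eqP|->]; last by rewrite mulr0.
by rewrite mulf_eq0 pnatr_eq0 => /eqP.
Qed.
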